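(* Let $a>1$ and $b>1$ be integers, let $n=a+b-2$, and consider the 2-connected $(a,b)$-puzzle on $V=\{1,\dots,n\}$, i.e. the cycle set consisting of the two cycles $\alpha=(1\ 2\ \dots\ a)$ and $\beta=(a-1\ a\ a+1\ \dots\ n)$. Its configuration group $H=\langle\alpha,\beta\rangle\le S_n$ is: 1. isomorphic to $S_{n-1}=S_5$ if $a=b=4$; 2. the alternating group $A_n$ if both $a$ and $b$ are odd; 3. the symmetric group $S_n$ otherwise. Moreover, any permutation in $H$ can be generated in $O(n^2)$ shifts; that is, there is an absolute constant $K$ (independent of $a,b$) such that every element of $H$ is a product of at most $Kn^2$ factors, each of which is one of $\alpha,\alpha^{-1},\beta,\beta^{-1}$.
   Context: Permutations are written in cycle notation. A shift along a cycle $(v_1\ \dots\ v_j)$ corresponds to applying the permutation $(v_1\ \dots\ v_j)$ or its inverse to the tokens placed on the vertices of $V$. The configuration group of a cycle set is the subgroup of $S_n$ generated by the permutations corresponding to its cycles. $A_n$ denotes the group of even permutations and $S_n$ the group of all permutations of $\{1,\dots,n\}$. *)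

(* Defs.v *)
From HB Require Import structures.
From mathcomp Require Import all_boot all_fingroup all_solvable.
Set Implicit Arguments. Unset Strict Implicit. Unset Printing Implicit Defensive.
Import GroupScope.

(* The cyclic permutation (s_0 s_1 ... s_{k-1}) of a finite type T:
   maps s_i to s_{i+1 mod k} and fixes everything not in s.
   (For a duplicate-free s, path.next s is injective; otherwise we return
   the identity, a case never used below.) *)
Definition cycle_perm (T : finType) (s : seq T) : {perm T} :=
  match injectiveb (next s) as c return injectiveb (next s) = c -> {perm T} with
  | true => fun h => perm (elimT (injectiveP (next s)) h)
  | false => fun _ => 1
  end erefl.

(* Vertices V = {1,...,n} with n = a+b-2 are encoded as 'I_n, vertex v being
   the ordinal v-1. *)
Definition puzzle_n (a b : nat) := (a + b - 2)%N.

Definition puzzle_alpha (a b : nat) : {perm 'I_(puzzle_n a b)} :=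
  cycle_perm (pmap insub (iota 0 a)).

Definition puzzle_beta (a b : nat) : {perm 'I_(puzzle_n a b)} :=
  cycle_perm (pmap insub (iota (a - 2) b)).

Definition puzzle_group (a b : nat) : {group {perm 'I_(puzzle_n a b)}} :=
  <<[set puzzle_alpha a b; puzzle_beta a b]>>%G.

Definition puzzle_shifts (a b : nat) : seq {perm 'I_(puzzle_n a b)} :=
  [:: puzzle_alpha a b; (puzzle_alpha a b)^-1; puzzle_beta a b; (puzzle_beta a b)^-1].

(* Main.v *)
Require Import Defs.
From HB Require Import structures.
From mathcomp Require Import all_boot all_fingroup all_solvable.
From mathcomp Require Import zify.
Import GroupScope.
Set Implicit Arguments. Unset Strict Implicit. Unset Printing Implicit Defensive.

(* The product gamma = alpha beta^-1 fixes vertex a-1 and permutes the other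
   n-1 vertices in one cycle.  Outside the case a = b = 4, a word of bounded
   length yields a 3-cycle (x, gamma x, gamma^2 x): directly from alpha or beta
   when one of them has length 2 or 3, from the double transposition
   [alpha, beta] = (1 a+1)(a-1 a) and its conjugates when one of them has
   length at least 6, and from explicit words in the three remaining cases.
   Moving tokens with gamma and with a gamma-like (n-3)-cycle makes all 3-cycles
   through vertex a-1 words of length O(n), and an even permutation is a product
   of at most n of these.
   For a = b = 4 the group preserves a 1-factorization of K_6, and its action on
   the five perfect matchings is the exotic isomorphism with S_5. *)

(** * Products of bounded length over a list of generators *)

Definition word_le (gT : finGroupType) (S : seq gT) (l : nat) (g : gT) : Prop :=
  exists s : seq gT,
    [/\ (size s <= l)%N, all (fun g => g \in S) s & g = \prod_(x <- s) x].

Section WordLength.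
Variables (gT : finGroupType) (S : seq gT).
Implicit Types (l k : nat) (g h : gT).

Lemma word_leW l k g : l <= k -> word_le S l g -> word_le S k g.
Proof. by move=> lk [s [sl Ss ->]]; exists s; split=> //; apply: leq_trans lk. Qed.

Lemma word_le1 l : word_le S l 1.
Proof. by exists [::]; rewrite big_nil. Qed.

Lemma word_le_gen g : g \in S -> word_le S 1 g.
Proof. by move=> Sg; exists [:: g]; rewrite /= Sg big_seq1. Qed.

Lemma word_leM l k g h :
  word_le S l g -> word_le S k h -> word_le S (l + k) (g * h).
Proof.
move=> [s [sl Ss ->]] [t [tk St ->]]; exists (s ++ t).
by rewrite size_cat leq_add // all_cat Ss St big_cat.
Qed.

Lemma word_leX l g m : word_le S l g -> word_le S (m * l) (g ^+ m).
Proof.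
move=> Wg; elim: m => [|m IHm]; first exact: word_le1.
by rewrite mulSn expgS; apply: word_leM.
Qed.

Lemma word_le_mem_gen l g : word_le S l g -> g \in <<[set x in S]>>.
Proof.
move=> [s [_ /allP Ss ->]]; rewrite big_seq.
by apply: group_prod => x /Ss Sx; apply: mem_gen; rewrite inE.
Qed.

Hypothesis invS : {in S, forall x, x^-1 \in S}.

Lemma word_leV l g : word_le S l g -> word_le S l g^-1.
Proof.
move=> [s [sl Ss ->]]; exists (rev [seq x^-1 | x <- s]); split.
- by rewrite size_rev size_map.
- by rewrite all_rev all_map; apply: sub_all Ss => x /invS.
elim: {sl Ss} s => [|x s IHs]; first by rewrite !big_nil invg1.
by rewrite big_cons invMg IHs /= rev_cons -cats1 big_cat big_seq1.
Qed.

Lemma word_leJ l k g h :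
  word_le S l g -> word_le S k h -> word_le S (l + 2 * k) (g ^ h).
Proof.
move=> Wg Wh; rewrite conjgE; apply: (@word_leW (k + (l + k))); first by lia.
by apply: word_leM (word_leM Wg Wh); apply: word_leV.
Qed.

End WordLength.

(** * Even permutations as short products of 3-cycles *)

Section ThreeCycles.
Variable T : finType.
Implicit Types (x y z u v : T) (g s : {perm T}).

(** Products apply the left factor first, so for distinct points this is the cycle x -> y -> z ->
    x. *)
Definition cyc3 x y z : {perm T} := tperm x y * tperm x z.

Lemma cyc3V x y z : (cyc3 x y z)^-1 = cyc3 x z y.
Proof. by rewrite invMg !tpermV. Qed.

Lemma cyc3J x y z g : (cyc3 x y z) ^ g = cyc3 (g x) (g y) (g z).
Proof. by rewrite conjMg !tpermJ. Qed.

Lemma cyc3E x y z : uniq [:: x; y; z] ->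
  [/\ cyc3 x y z x = y, cyc3 x y z y = z & cyc3 x y z z = x].
Proof.
rewrite /= !inE negb_or => /and3P[/andP[xy xz] yz _].
rewrite !permM tpermL tpermR tpermL.
by split; rewrite ?[tperm x y z]tpermD ?tpermR ?tpermD // eq_sym.
Qed.

Lemma cyc3D x y z u : u != x -> u != y -> u != z -> cyc3 x y z u = u.
Proof. by move=> ux uy uz; rewrite permM !tpermD // eq_sym. Qed.

Lemma cyc3_rot x y z : uniq [:: x; y; z] -> cyc3 x y z = cyc3 y z x.
Proof.
move=> u3; have u3' : uniq [:: y; z; x] by rewrite -(rot_uniq 2).
have [ex ey ez] := cyc3E u3; have [fy fz fx] := cyc3E u3'.
apply/permP=> t; have [->|tx] := eqVneq t x; first by rewrite ex fx.
have [->|ty] := eqVneq t y; first by rewrite ey fy.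
have [->|tz] := eqVneq t z; first by rewrite ez fz.
by rewrite !cyc3D.
Qed.

Lemma odd_cyc3 x y z : uniq [:: x; y; z] -> cyc3 x y z = false :> bool.
Proof.
rewrite /= !inE negb_or => /and3P[/andP[xy xz] yz _].
by rewrite odd_permM !odd_tperm xy xz.
Qed.

(* If [s] moves some [z] other than [p] and [q], composing it with a 3-cycle
   through [p] fixes [z] without moving any fixed point other than [p], [q]. *)
Lemma even_word_le (S : seq {perm T}) (p q : T) (l : nat) :
    {in S, forall g, g^-1 \in S} -> p != q ->
    (forall y z, uniq [:: p; y; z] -> word_le S l (cyc3 p y z)) ->
  forall s, ~~ odd_perm s -> word_le S (#|T| * l) s.
Proof.
move=> invS pq Wc s even_s.
pose M s := [set z | [&& s z != z, z != p & z != q]].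
suff: word_le S (#|M s| * l) s.
  by apply: word_leW; rewrite leq_mul2r max_card orbT.
have [m] := ubnP #|M s|; elim: m s even_s => // m IHm s even_s; rewrite ltnS => leMm.
have [M0 | [z]] := set_0Vmem (M s).
  (* When at most [p] and [q] are moved, [s] is the identity or their transposition, and parity
     excludes the latter. *)
  suff -> : s = 1 by apply: word_le1.
  have fixs z : z != p -> z != q -> s z = z.
    move=> zp zq; apply/eqP; apply: contraT => nz.
    by rewrite -(in_set0 z) -M0 inE nz zp zq.
  have spq x : x \in pred2 p q -> s x \in pred2 p q.
    rewrite !inE => xpq; apply: contraT; rewrite negb_or => /andP[sp sq].
    by move: (fixs _ sp sq) => /perm_inj sx; rewrite -sx (negPf sp) (negPf sq) in xpq.
  have [sp | sp] := eqVneq (s p) p.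
    apply/permP=> z; rewrite perm1; have [-> //|zp] := eqVneq z p.
    have [->|zq] := eqVneq z q; last exact: fixs.
    have := spq q; rewrite !inE eqxx orbT => /(_ isT)/orP[]/eqP // sq.
    by move: pq; rewrite -(inj_eq (@perm_inj _ s)) sp sq eqxx.
  suff es : s = tperm p q by move: even_s; rewrite es odd_tperm pq.
  have sp' : s p = q by have := spq p; rewrite !inE eqxx (negPf sp) => /(_ isT)/eqP.
  apply/permP=> z; have [->|zp] := eqVneq z p; first by rewrite tpermL.
  have [->|zq] := eqVneq z q; last by rewrite tpermD 1?eq_sym ?fixs.
  rewrite tpermR; have := spq q; rewrite !inE eqxx orbT => /(_ isT)/orP[]/eqP // sq.
  by move: pq; rewrite -(inj_eq (@perm_inj _ s)) sq sp' eqxx.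
rewrite inE => /and3P[sz zp zq].
have [c [Wc_c even_c cz cfix]] : exists c : {perm T}, [/\ word_le S l c, ~~ odd_perm c,
    c (s z) = z & forall w, s w = w -> w != p -> w != q -> w != z -> c w = w].
  have [szp | szp] := eqVneq (s z) p.
    (* When [s z] is [p] itself, [q] serves as the third point: [M] does not count it, so it may be
       moved freely. *)
    have u3 : uniq [:: p; z; q] by rewrite /= !inE negb_or pq zq eq_sym zp.
    exists (cyc3 p z q); rewrite odd_cyc3 // szp; have [-> _ _] := cyc3E u3.
    by split=> // [|w *]; [apply: Wc | apply: cyc3D].
  have u3 : uniq [:: p; s z; z].
    by rewrite /= !inE negb_or sz 2!(eq_sym p) szp zp.
  exists (cyc3 p (s z) z); rewrite odd_cyc3 //; have [_ -> _] := cyc3E u3.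
  split=> // [|w sw wp wq wz]; first exact: Wc.
  by apply: cyc3D => //; rewrite -[w]sw (inj_eq perm_inj).
have ltM : #|M (s * c)| < #|M s|.
  apply/proper_card/properP; split.
    apply/subsetP => w; rewrite !inE permM => /and3P[scw wp wq].
    rewrite wp wq !andbT; apply: contra scw => /eqP sw; rewrite sw cfix //.
    by apply: contraNneq sz => <-; rewrite sw.
  by exists z; rewrite !inE ?permM ?cz ?eqxx // sz zp.
rewrite -[X in word_le _ _ X](mulgK c); apply: (@word_leW _ _ (#|M (s * c)| * l + l)).
  by rewrite addnC -mulSn leq_mul2r ltM orbT.
apply: word_leM; last exact: word_leV.
apply: IHm; last exact: leq_trans ltM leMm.
by rewrite odd_permM (negPf even_s) (negPf even_c).
Qed.

End ThreeCycles.

(** Conjugation by [c ^+ k * e] carries the given 3-cycle to one through the fixed point [r] of [c].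
    Powers of [c], and then of a cycle that fixes a second point as well, put the other two entries
    in place. Every 3-cycle through [r] thus has a word of length O(nl), and [even_word_le]
    applies. *)
Lemma even_word_le_cycle (T : finType) (S : seq {perm T})
    (r x0 : T) (c e : {perm T}) (l : nat) :
    {in S, forall g, g^-1 \in S} ->
    3 < #|T| -> porbit c x0 = [set~ r] -> e r != r ->
    word_le S l c -> word_le S l e ->
    word_le S l (cyc3 x0 (c x0) (c (c x0))) ->
  forall s, ~~ odd_perm s -> word_le S (45 * l * #|T| ^ 2) s.
Proof.
move=> invS gt3 orb er Wc We W3.
pose n := #|T|; pose x i := (c ^+ i) x0.
have card_orb : #|porbit c x0| = n.-1.
  by have := cardsC1 r; rewrite -orb -/n => ->.
have xS i : c (x i) = x i.+1 by rewrite /x expgSr permM.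
have x_inj i j : i < n.-1 -> j < n.-1 -> (x i == x j) = (i == j).
  have tr i' : i' < n.-1 -> x i' = nth x0 (traject c x0 n.-1) i'.
    by move=> ?; rewrite nth_traject // /x permX.
  move=> li lj; rewrite !tr // nth_uniq ?size_traject //.
  by rewrite -card_orb uniq_traject_porbit.
have x_per : x n.-1 = x 0 by rewrite /x permX -card_orb iter_porbit perm1.
have xr i : x i != r.
  by have := mem_porbit c i x0; rewrite orb !inE.
have xP y : y != r -> exists2 i, i < n.-1 & y = x i.
  move=> yr; have: y \in porbit c x0 by rewrite orb !inE.
  rewrite porbit_traject card_orb => /trajectP[i li ->].
  by exists i => //; rewrite /x permX.
have cr : c r = r.
  apply/eqP; apply: contraT => /xP[[|i] li].
    rewrite -x_per (_ : n.-1 = n.-2.+1) -?xS; last by rewrite /n; lia.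
    by move=> /perm_inj E; have := xr n.-2; rewrite -E eqxx.
  by rewrite -xS => /perm_inj E; have := xr i; rewrite -E eqxx.
have cX i : (c ^+ i) r = r by elim: i => [|i IH]; rewrite ?perm1 // expgSr permM IH.
have [W1l l0] : (forall i, i <= n -> word_le S (n * l) (c ^+ i)) /\ 3 <= n.-1.
  split; last by rewrite /n; lia.
  by move=> i li; apply: word_leW (word_leX i Wc); rewrite leq_mul2r li orbT.
pose t := cyc3 (x 0) (x 1%N) (x 2).
have Wt : word_le S l t by move: W3; rewrite /t -!xS /x perm1.
(* [d] fixes [r], [x 0], [x 1] and cycles the remaining points. *)
pose d := c * t^-1.
have [te0 te1 te2] : [/\ t (x 0) = x 1%N, t (x 1%N) = x 2 & t (x 2) = x 0].
  by apply: cyc3E; rewrite /= !inE !x_inj //; lia.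
have dr : d r = r.
  by apply: (@perm_inj _ t); rewrite [d _]permM permKV cr cyc3D // eq_sym.
have d1 : d (x 1%N) = x 1%N.
  by apply: (@perm_inj _ t); rewrite [d _]permM permKV xS te1.
have dS i : (1 < i)%N -> i.+1 < n.-1 -> d (x i) = x i.+1.
  move=> i1 ln; apply: (@perm_inj _ t); rewrite [d _]permM permKV xS cyc3D // x_inj //; lia.
have Wd : word_le S (2 * l) d.
  rewrite mul2n -addnn; by apply: word_leM => //; apply: word_leV.
have dX i : (d ^+ i) r = r /\ (d ^+ i) (x 1%N) = x 1%N.
  elim: i => [|i [IH1 IH2]]; first by rewrite !perm1.
  by rewrite expgSr; split; rewrite permM ?IH1 ?IH2.
have dX2 i : i.+2 < n.-1 -> (d ^+ i) (x 2) = x i.+2.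
  elim: i => [|i IH] ln; first by rewrite perm1.
  by rewrite expgSr permM IH ?dS //; lia.
have WdX i : i <= n -> word_le S (n * (2 * l)) (d ^+ i).
  by move=> li; apply: word_leW (word_leX i Wd); rewrite leq_mul2r li orbT.
have [u [v [Wuv ru rv uv]]] : exists u v,
    [/\ word_le S ((2 * n + 3) * l) (cyc3 r u v), u != r, v != r & u != v].
  (* Since [e] moves [r], the preimage of [r] under [e] lies on the orbit of [c]. *)
  have [k lk Ek] : exists2 k, k < n.-1 & e^-1 r = x k.
    by apply: xP; apply: contraNneq er => E; rewrite -{1}E permKV.
  pose g := c ^+ k * e.
  have gx0 : g (x 0) = r by rewrite permM /x perm1 -/(x k) -Ek permKV.
  exists (g (x 1%N)), (g (x 2)); rewrite -gx0 !(inj_eq perm_inj) !x_inj; try lia.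
  split=> //; rewrite -cyc3J; apply: (@word_leW _ _ (l + 2 * (n * l + l))).
    by lia.
  by apply: word_leJ => //; apply: word_leM => //; apply: W1l; lia.
have Wr12 : word_le S ((8 * n + 5) * l) (cyc3 r (x 1%N) (x 2)).
  have [k lk Ek] : exists2 k, k <= n & (c ^+ k) u = x 1%N.
    have [j lj ->] := xP _ ru.
    have cxx a b : (c ^+ a) (x b) = x (b + a) by rewrite /x expgD permM.
    (* The orbit has n - 1 points, so n - j steps from [x j] lead to index n, which is [x 1]
       again. *)
    have [j1|j1] := leqP j 1%N; [exists (1 - j)%N|exists (n - j)]; try lia.
      by rewrite cxx; congr x; lia.
    rewrite cxx (_ : j + (n - j) = n.-1.+1); last by lia.
    by rewrite -xS x_per xS.
  have W' : word_le S ((4 * n + 3) * l) (cyc3 r (x 1%N) ((c ^+ k) v)).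
    rewrite -{1}(cX k) -Ek -cyc3J.
    by apply: word_leW (word_leJ invS Wuv (W1l k lk)); lia.
  have [j lj Ej] : exists2 j, j < n.-1 & (c ^+ k) v = x j.
    by apply: xP; rewrite -[X in _ != X](cX k) (inj_eq perm_inj).
  have j1 : j != 1%N.
    by rewrite -x_inj -?Ej -?Ek ?(inj_eq perm_inj) 1?eq_sym //; lia.
  (* The third entry may be [x 0], which [d] fixes; inversion and conjugation by [c] settle that
     case. From any other position a negative power of [d] brings it back to [x 2]. *)
  rewrite Ej in W'; case: j j1 lj Ej W' => [|[//|j]] _ lj _ W'.
    rewrite -cr -[x 2]xS -[x 1%N]xS -cyc3J xS -cyc3V.
    by apply: word_leW (word_leJ invS (word_leV invS W') Wc); lia.
  rewrite -dX2 // -[x 1%N](proj2 (dX j)) -{1}(proj1 (dX j)) -cyc3J in W'.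
  have jn : j <= n by lia.
  have := word_leJ invS W' (word_leV invS (WdX j jn)).
  by rewrite conjgK; apply: word_leW; lia.
have x1r := xr 1%N.
have Wr1 y : y != r -> y != x 1%N -> word_le S ((12 * n + 5) * l) (cyc3 r (x 1%N) y).
  move=> /xP[[|[|j]] lj ->]; rewrite ?eqxx // => _.
    have E : cyc3 r (x 0) (x 1%N) = cyc3 r (x 1%N) (x 2) ^ c^-1.
      by apply: (canRL (conjgK c)); rewrite cyc3J !xS cr.
    rewrite -cyc3V E; apply: word_leV => //.
    by apply: word_leW (word_leJ invS Wr12 (word_leV invS Wc)); nia.
  rewrite -dX2 // -[x 1%N](proj2 (dX j)) -{1}(proj1 (dX j)) -cyc3J.
  have jn : j <= n by lia.
  by apply: word_leW (word_leJ invS Wr12 (WdX j jn)); lia.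
(* The costliest 3-cycle through [r] below takes three words of length (12n + 5)l, and 36n + 15 <=
   45n. *)
move=> s even_s; apply: (@word_leW _ _ (#|T| * (45 * n * l))).
  by rewrite -/n; lia.
apply: (even_word_le (p := r) (q := x 1%N)) => // {s even_s}; first by rewrite eq_sym.
move=> y z /=; rewrite !inE negb_or !(eq_sym r) => /and3P[/andP[yr zr] yz _].
have [Ey|y1] := eqVneq y (x 1%N).
  by rewrite Ey; apply: (word_leW _ (Wr1 z zr _)); [nia | rewrite -Ey eq_sym].
have [->|z1] := eqVneq z (x 1%N).
  rewrite -cyc3V; apply: word_leV => //.
  by apply: (word_leW _ (Wr1 y yr y1)); nia.
have u3 : uniq [:: r; z; x 1%N] by rewrite /= !inE negb_or !(eq_sym r) zr x1r z1.
have u3' : uniq [:: z; r; y] by rewrite /= !inE negb_or zr !(eq_sym _ y) yz yr.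
(* The conjugating permutation sends [r] to [z] and [x 1] to [r], and fixes [y]. *)
have -> : cyc3 r y z = cyc3 r (x 1%N) y ^ (cyc3 r (x 1%N) z)^-1.
  rewrite cyc3J cyc3V; have [-> _ ->] := cyc3E u3.
  by rewrite (cyc3D yr yz y1) (cyc3_rot u3').
apply: (word_leW _ (word_leJ invS (Wr1 y yr y1) (word_leV invS (Wr1 z zr z1)))); nia.
Qed.

(** * The two cycles as functions on natural numbers *)

Lemma cycle_permE (T : finType) (s : seq T) : uniq s -> cycle_perm s =1 next s.
Proof.
move=> Us x; rewrite /cycle_perm; move: (erefl (injectiveb (next s))).
case: {2 3}(injectiveb _) => [h|]; first by rewrite permE.
by move=> /negbT/negP[]; apply/injectiveP; apply: can_inj (prev_next Us).
Qed.

Lemma val_pmap_insub n (s : seq nat) :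
  all (gtn n) s -> map val (pmap (insub : nat -> option 'I_n) s) = s.
Proof.
move=> /allP sn; rewrite (pmap_filter (insubK _)).
rewrite (eq_in_filter (a2 := predT)) ?filter_predT //.
by move=> x /sn /= xn; rewrite insubT.
Qed.

Lemma val_cycle_perm n (s : seq nat) (i : 'I_n) :
  uniq s -> all (gtn n) s -> nat_of_ord (cycle_perm (pmap insub s) i) = next s i.
Proof.
move=> Us sn; rewrite cycle_permE ?pmap_sub_uniq // -[LHS]/(val _).
by rewrite -(next_map val_inj) ?pmap_sub_uniq // val_pmap_insub.
Qed.

Lemma val_cycle_permV n (s : seq nat) (i : 'I_n) :
  uniq s -> all (gtn n) s -> nat_of_ord ((cycle_perm (pmap insub s))^-1 i) = prev s i.
Proof.
move=> Us sn; rewrite -{2}[i](permKV (cycle_perm (pmap insub s))).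
by rewrite val_cycle_perm // prev_next.
Qed.

(** Model of the cycle (k k+1 ... l-1) on plain naturals: identities between puzzle permutations
    become linear arithmetic. *)
Definition rotn (k l i : nat) : nat :=
  if k <= i < l then if i.+1 == l then k else i.+1 else i.

Lemma rotnP k l i :
  k <= i /\ i.+1 < l /\ rotn k l i = i.+1 \/ k <= i /\ i.+1 = l /\ rotn k l i = k \/
  (i < k \/ l <= i) /\ rotn k l i = i.
Proof. by rewrite /rotn; repeat case: ifP; lia. Qed.

Ltac rot_lia :=
  repeat match goal with |- context [rotn ?k ?l ?i] =>
    have := rotnP k l i; generalize (rotn k l i); intros end; lia.

Definition rotnV (k l i : nat) : nat :=
  if k <= i < l then if i == k then l.-1 else i.-1 else i.

Lemma rotnK k l : k < l -> cancel (rotn k l) (rotnV k l).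
Proof. by move=> kl i; rewrite /rotn /rotnV; repeat case: ifP; lia. Qed.

Lemma next_iota k l i : 0 < l -> next (iota k l) i = rotn k (k + l) i.
Proof.
move=> l0; rewrite next_nth mem_iota /rotn; case: ifP => // /andP[ki il].
case: l l0 il => // l _ il.
have -> : index i (iota k l.+1) = i - k.
  have {1}-> : i = nth 0 (iota k l.+1) (i - k) by rewrite nth_iota; lia.
  by rewrite index_uniq ?iota_uniq // size_iota; lia.
rewrite /=; case: eqP => kl; first by rewrite nth_default // size_iota; lia.
by rewrite nth_iota; lia.
Qed.

Section Puzzle.
Variables a b : nat.
Hypotheses (a1 : 1 < a) (b1 : 1 < b).
Local Notation n := (puzzle_n a b).
Local Notation al := (puzzle_alpha a b).
Local Notation be := (puzzle_beta a b).

Lemma val_alpha (i : 'I_n) : nat_of_ord (al i) = rotn 0 a (nat_of_ord i).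
Proof.
rewrite val_cycle_perm ?iota_uniq ?next_iota //; first by lia.
by apply/allP=> x; rewrite mem_iota /puzzle_n /=; lia.
Qed.

Lemma val_beta (i : 'I_n) : nat_of_ord (be i) = rotn (a - 2) n (nat_of_ord i).
Proof.
rewrite val_cycle_perm ?iota_uniq ?next_iota //; first by congr rotn; rewrite /puzzle_n; lia.
  by lia.
by apply/allP=> x; rewrite mem_iota /puzzle_n /=; lia.
Qed.

Lemma val_alphaV (i : 'I_n) : nat_of_ord (al^-1 i) = rotnV 0 a (nat_of_ord i).
Proof. by rewrite -{2}[i](permKV al) val_alpha rotnK //; lia. Qed.

Lemma val_betaV (i : 'I_n) : nat_of_ord (be^-1 i) = rotnV (a - 2) n (nat_of_ord i).
Proof. by rewrite -{2}[i](permKV be) val_beta rotnK // /puzzle_n; lia. Qed.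

End Puzzle.

(** * The commutator of the two cycles *)

Definition swapn (x y z : nat) : nat := if z == x then y else if z == y then x else z.

Lemma swapnP x y z :
  z = x /\ swapn x y z = y \/ z <> x /\ z = y /\ swapn x y z = x \/
  z <> x /\ z <> y /\ swapn x y z = z.
Proof. by rewrite /swapn; repeat case: ifP; lia. Qed.

Lemma val_tperm n (x y z : 'I_n) : tperm x y z = swapn x y z :> nat.
Proof.
rewrite /swapn permE /= -!val_eqE /=.
by do 2 case: ifP => // _.
Qed.

(** Pointwise form of [alpha, beta] = (0 a)(a-2 a-1). The pair {0, a} is taken in either order so
    that [p] can be chosen off alpha or off beta. *)
Lemma rotn_comm a b p w j : 2 < a -> 2 < b -> j < a + b - 2 ->
  (p = 0 /\ w = a) \/ (p = a /\ w = 0) ->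
  rotn (a - 2) (a + b - 2) (rotn 0 a j) =
  swapn (a - 2) (a - 1) (swapn w p (rotn 0 a (rotn (a - 2) (a + b - 2) j))).
Proof.
move=> a3 b3; move Em : (a + b - 2) => m ltjn Ep.
case: (rotnP 0 a j) => [|[]] [? ?]; case: (rotnP (a - 2) m j) => [|[]] [? ?];
  try (exfalso; lia); move: (rotnP 0 a (rotn (a - 2) m j)) (rotnP (a - 2) m (rotn 0 a j));
  move: (rotn (a - 2) m (rotn 0 a j)) (rotn 0 a (rotn (a - 2) m j)) => j1 j2;
  (case=> [|[]] [? ?]; try (exfalso; lia)); (case=> [|[]] [? ?]; try (exfalso; lia));
  (case: (swapnP w p j2) => [|[]] ?; try (exfalso; lia));
  (case: (swapnP (a - 2) (a - 1) (swapn w p j2)) => [|[]] ?; lia).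
Qed.

Section PuzzleWords.
Variables a b : nat.
Hypotheses (a1 : 1 < a) (b1 : 1 < b).
Local Notation n := (puzzle_n a b).
Local Notation al := (puzzle_alpha a b).
Local Notation be := (puzzle_beta a b).
Local Notation W := (word_le (puzzle_shifts a b)).

Lemma puzzle_shiftsV : {in puzzle_shifts a b, forall g, g^-1 \in puzzle_shifts a b}.
Proof.
by move=> g; rewrite !inE => /or4P[]/eqP->; rewrite ?invgK eqxx ?orbT.
Qed.

Lemma word_le_alpha : W 1 al.
Proof. by apply: word_le_gen; rewrite !inE eqxx. Qed.

Lemma word_le_beta : W 1 be.
Proof. by apply: word_le_gen; rewrite !inE eqxx !orbT. Qed.

Lemma ord_of_nat m k : k < m -> exists i : 'I_m, nat_of_ord i = k.
Proof. by move=> km; exists (Ordinal km). Qed.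

Lemma puzzle_comm (p w0 w1 w2 : 'I_n) : 2 < a -> 2 < b ->
  nat_of_ord w0 = a - 2 -> nat_of_ord w1 = a - 1 ->
  (nat_of_ord p = 0 /\ nat_of_ord w2 = a) \/ (nat_of_ord p = a /\ nat_of_ord w2 = 0) ->
  [~ al, be] = tperm w2 p * tperm w0 w1.
Proof.
move=> a3 b3 E0 E1 Ep.
suff E : al * be = be * al * (tperm w2 p * tperm w0 w1).
  by rewrite commgEl conjgE E -!mulgA !mulKg.
apply/permP=> i; apply: ord_inj.
rewrite !permM !val_tperm val_beta // !val_alpha // val_beta // E0 E1.
by apply: rotn_comm => //; apply: ltn_ord.
Qed.

(* With [t_k := t ^ (h ^+ k)], the supports of [t_0] and [t_3] meet only in [p],
   so [(t_0 t_3)^2 = t_0 * t_0 ^ t_3] is a 3-cycle; conjugation by [t_2] turns it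
   into a 3-cycle of consecutive points. *)
Lemma comm_cyc3 (h : {perm 'I_n}) (p w0 w1 w2 w3 w4 w5 : 'I_n) :
  uniq [:: p; w0; w1; w2; w3; w4; w5] ->
  [/\ h w0 = w1, h w1 = w2, h w2 = w3, h w3 = w4 & h w4 = w5] -> h p = p ->
  W 1 h -> W 4 (tperm w2 p * tperm w0 w1) -> W 44 (cyc3 w3 w4 w5).
Proof.
move=> u7 [h0 h1 h2 h3 h4] hp Wh; set t := _ * _ => Wt.
have invS := puzzle_shiftsV.
have Et2 : t ^ (h ^+ 2) = tperm w4 p * tperm w2 w3.
  by rewrite conjMg !tpermJ !expgS !permM !perm1 !(h0, h1, h2, h3, h4, hp).
have Et3 : t ^ (h ^+ 3) = tperm w5 p * tperm w3 w4.
  by rewrite conjMg !tpermJ !expgS !permM !perm1 !(h0, h1, h2, h3, h4, hp).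
have Wt2 : W 8 (t ^ (h ^+ 2)) by apply: word_leW (word_leJ invS Wt (word_leX 2 Wh)).
have Wt3 : W 10 (t ^ (h ^+ 3)) by apply: word_leW (word_leJ invS Wt (word_leX 3 Wh)).
(* The product [t * t ^ t_3] has 4 + (4 + 2 * 10) = 28 letters, and conjugation by [t_2] adds 2 * 8,
   whence 44. *)
have := word_leJ invS (word_leM Wt (word_leJ invS Wt Wt3)) Wt2.
have := u7; rewrite /= !inE !negb_or -!andbA => D.
repeat match goal with H : is_true (_ && _) |- _ => case/andP: H => ? ? end.
have -> : t * t ^ (t ^ (h ^+ 3)) = cyc3 w2 p w5.
  have -> : t ^ (t ^ (h ^+ 3)) = tperm w2 w5 * tperm w0 w1.
    rewrite Et3 conjMg !tpermJ !permM.
    rewrite [tperm w5 p w2]tpermD ?[tperm w5 p w0]tpermD ?[tperm w5 p w1]tpermD ?tpermL ?tpermR.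
    all: try by rewrite // eq_sym.
    by rewrite !tpermD // eq_sym.
  (* The two copies of [tperm w0 w1] cancel around the disjoint [tperm w2 w5]. *)
  rewrite /t /cyc3 -mulgA; congr (_ * _).
  rewrite -{1}(tpermV w0 w1) -conjgE tpermJ.
  by rewrite !tpermD // eq_sym.
rewrite cyc3J Et2 !permM tpermR.
rewrite [tperm w4 p w2]tpermD ?[tperm w4 p w5]tpermD ?tpermL.
all: try by rewrite // eq_sym.
by rewrite !tpermD // eq_sym.
Qed.

End PuzzleWords.

(** * A bounded word for a 3-cycle of consecutive points of gamma *)

Section ShortThreeCycle.
Variables a b : nat.
Hypotheses (a1 : 1 < a) (b1 : 1 < b).
Local Notation n := (puzzle_n a b).
Local Notation al := (puzzle_alpha a b).
Local Notation be := (puzzle_beta a b).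
Local Notation W := (word_le (puzzle_shifts a b)).
Local Notation ga := (al * be^-1).

Lemma alphaP (i j : 'I_n) : rotn 0 a (nat_of_ord i) = nat_of_ord j -> al i = j.
Proof. by move=> E; apply: ord_inj; rewrite val_alpha. Qed.

Lemma betaP (i j : 'I_n) : rotn (a - 2) n (nat_of_ord i) = nat_of_ord j -> be i = j.
Proof. by move=> E; apply: ord_inj; rewrite val_beta. Qed.

(** Comparing [al i] with [be j] keeps the inverse of [be] out of the arithmetic. *)
Lemma gammaP (i j : 'I_n) : rotn 0 a (nat_of_ord i) = rotn (a - 2) n (nat_of_ord j) -> ga i = j.
Proof.
by move=> E; rewrite permM; apply: (canLR (permK be)); apply: ord_inj; rewrite val_alpha ?val_beta.
Qed.

(** The starting 3-cycle for [even_word_le_cycle]. The ordinal [a - 2] is vertex a-1, the fixed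
    point of [ga], and 50 bounds all cases, the longest word being the one of 44 letters from
    [comm_cyc3]. *)
Definition short_cyc3 := exists2 u : 'I_n,
  nat_of_ord u != (a - 2)%N & W 50 (cyc3 u (ga u) (ga (ga u))).

Lemma short_cyc3I (u v w : 'I_n) : nat_of_ord u != (a - 2)%N ->
  rotn 0 a (nat_of_ord u) = rotn (a - 2) n (nat_of_ord v) ->
  rotn 0 a (nat_of_ord v) = rotn (a - 2) n (nat_of_ord w) ->
  W 50 (cyc3 u v w) -> short_cyc3.
Proof. by move=> ur /gammaP uv /gammaP vw Wuvw; exists u => //; rewrite uv vw. Qed.

(** Alpha is a transposition sharing one point with its conjugate by beta, so their product is a
    3-cycle; a further conjugation makes its points consecutive for [ga]. *)
Lemma short_cyc3_a2 : a = 2 -> 3 < n -> short_cyc3.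
Proof.
move=> a2 n4; have lt_n k : k < 4 -> k < n by lia.
have [z0 E0] := ord_of_nat (lt_n 0 isT); have [z1 E1] := ord_of_nat (lt_n 1%N isT).
have [z2 E2] := ord_of_nat (lt_n 2 isT); have [z3 E3] := ord_of_nat (lt_n 3 isT).
have Eal : al = tperm z1 z0.
  apply/permP=> i; apply: ord_inj; rewrite val_alpha // val_tperm E1 E0.
  by have := rotnP 0 a i; have := swapnP 1 0 i; lia.
have [be0 be1 be2] : [/\ be z0 = z1, be z1 = z2 & be z2 = z3].
  by split; apply: betaP; rewrite ?E0 ?E1 ?E2 ?E3; rot_lia.
apply: (@short_cyc3I z3 z2 z1); rewrite ?E1 ?E2 ?E3; try rot_lia.
have -> : cyc3 z3 z2 z1 = (al * al ^ be) ^ be.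
  rewrite {1}Eal {1}Eal tpermJ be0 be1 [tperm z1 z0]tpermC [tperm z2 z1]tpermC.
  rewrite [tperm z0 z1]tpermC -/(cyc3 z1 z0 z2) cyc3J be0 be1 be2.
  by rewrite [RHS]cyc3_rot 1?[RHS]cyc3_rot // /= !inE -!val_eqE /= E1 E2 E3.
have invS := @puzzle_shiftsV a b; have Wa := word_le_alpha a b; have Wb := word_le_beta a b.
by apply: word_leW (word_leJ invS (word_leM Wa (word_leJ invS Wa Wb)) Wb).
Qed.

Lemma short_cyc3_a3 : a = 3 -> 2 < b -> short_cyc3.
Proof.
move=> a3 b3; have n4 : 3 < n by rewrite /puzzle_n; lia.
have lt_n k : k < 4 -> k < n by lia.
have [z0 E0] := ord_of_nat (lt_n 0 isT); have [z1 E1] := ord_of_nat (lt_n 1%N isT).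
have [z2 E2] := ord_of_nat (lt_n 2 isT); have [z3 E3] := ord_of_nat (lt_n 3 isT).
have Eal : al = cyc3 z0 z1 z2.
  apply/permP=> i; apply: ord_inj; rewrite val_alpha // permM !val_tperm E2 E1 E0.
  have := swapnP 0 2 (swapn 0 1 (nat_of_ord i)).
  by have := rotnP 0 a i; have := swapnP 0 1 (nat_of_ord i); lia.
have [be0 be1 be2] : [/\ be z0 = z0, be z1 = z2 & be z2 = z3].
  by split; apply: betaP; rewrite ?E0 ?E1 ?E2 ?E3; rot_lia.
apply: (@short_cyc3I z3 z2 z0); rewrite ?E0 ?E2 ?E3; try rot_lia.
have -> : cyc3 z3 z2 z0 = (al ^ be)^-1.
  rewrite Eal cyc3J be0 be1 be2 cyc3V.
  by rewrite [RHS]cyc3_rot // /= !inE -!val_eqE /= E0 E2 E3.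
have invS := @puzzle_shiftsV a b; have Wa := word_le_alpha a b; have Wb := word_le_beta a b.
by apply: word_leW (word_leV invS (word_leJ invS Wa Wb)).
Qed.

(** Here beta is the transposition, and its product with its conjugate by alpha is a 3-cycle. *)
Lemma short_cyc3_b2 : b = 2 -> 3 < n -> short_cyc3.
Proof.
move=> b2 n4; have Ea : a = n by rewrite /puzzle_n; lia.
have lt_n k : 0 < k <= 2 -> n - k < n by lia.
have [z0 E0] : exists i : 'I_n, nat_of_ord i = 0 by apply: ord_of_nat; lia.
have [z1 E1] : exists i : 'I_n, nat_of_ord i = 1%N by apply: ord_of_nat; lia.
have [y1 F1] := ord_of_nat (lt_n 1%N isT); have [y2 F2] := ord_of_nat (lt_n 2 isT).
have Ebe : be = tperm y1 y2.
  apply/permP=> i; apply: ord_inj; rewrite val_beta // val_tperm F1 F2.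
  have := ltn_ord i.
  by have := rotnP (a - 2) n i; have := swapnP (n - 1) (n - 2) (nat_of_ord i); lia.
have [al0 al1 al2] : [/\ al y2 = y1, al y1 = z0 & al z0 = z1].
  by split; apply: alphaP; rewrite ?E0 ?E1 ?F1 ?F2; rot_lia.
apply: (@short_cyc3I y1 z0 z1); rewrite ?E0 ?E1 ?F1; try rot_lia.
have -> : cyc3 y1 z0 z1 = ((be * be ^ al) ^ al)^-1.
  rewrite {1}Ebe {1}Ebe tpermJ al0 al1 [tperm z0 y1]tpermC [tperm y1 y2]tpermC.
  rewrite [tperm y2 y1]tpermC -/(cyc3 y1 y2 z0) cyc3J al0 al1 al2 cyc3V.
  by rewrite [LHS]cyc3_rot // /= !inE -!val_eqE /= E0 E1 F1; lia.
have invS := @puzzle_shiftsV a b; have Wa := word_le_alpha a b; have Wb := word_le_beta a b.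
by apply: word_leW (word_leV invS (word_leJ invS (word_leM Wb (word_leJ invS Wb Wa)) Wa)).
Qed.

Lemma short_cyc3_b3 : b = 3 -> 2 < a -> short_cyc3.
Proof.
move=> b3 a3; have Ea : a = n - 1 by rewrite /puzzle_n; lia.
have lt_n k : 0 < k <= 3 -> n - k < n by lia.
have [z0 E0] : exists i : 'I_n, nat_of_ord i = 0 by apply: ord_of_nat; lia.
have [y1 F1] := ord_of_nat (lt_n 1%N isT); have [y2 F2] := ord_of_nat (lt_n 2 isT).
have [y3 F3] := ord_of_nat (lt_n 3 isT).
have Ebe : be = cyc3 y3 y2 y1.
  apply/permP=> i; apply: ord_inj; rewrite val_beta // permM !val_tperm F1 F2 F3.
  have := ltn_ord i.
  have := swapnP (n - 3) (n - 1) (swapn (n - 3) (n - 2) (nat_of_ord i)).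
  by have := rotnP (a - 2) n i; have := swapnP (n - 3) (n - 2) (nat_of_ord i); lia.
have [al0 al1 al2] : [/\ al y3 = y2, al y2 = z0 & al y1 = y1].
  by split; apply: alphaP; rewrite ?E0 ?F3 ?F1 ?F2; rot_lia.
apply: (@short_cyc3I y1 y2 z0); rewrite ?E0 ?F1 ?F2; try rot_lia.
have -> : cyc3 y1 y2 z0 = be ^ al.
  rewrite Ebe cyc3J al0 al1 al2.
  by rewrite [LHS]cyc3_rot // /= !inE -!val_eqE /= E0 F2 F1; lia.
have invS := @puzzle_shiftsV a b; have Wa := word_le_alpha a b; have Wb := word_le_beta a b.
by apply: word_leW (word_leJ invS Wb Wa).
Qed.

Lemma word_le_comm : W 4 [~ al, be].
Proof.
have invS := @puzzle_shiftsV a b; have Wa := word_le_alpha a b; have Wb := word_le_beta a b.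
rewrite commgEl; apply: word_leW (word_leM (word_leV invS Wa) (word_leJ invS Wa Wb)); lia.
Qed.

(** The points [w0], ..., [w5] follow each other on alpha from [a - 2], wrapping round to 0; they
    are distinct because a > 5. On [w3], [w4] gamma agrees with alpha. *)
Lemma short_cyc3_a6 : 5 < a -> 2 < b -> short_cyc3.
Proof.
move=> a6 b3; have En : n = a + b - 2 by [].
have [w0 E0] : exists i : 'I_n, nat_of_ord i = a - 2 by apply: ord_of_nat; lia.
have [w1 E1] : exists i : 'I_n, nat_of_ord i = a - 1 by apply: ord_of_nat; lia.
have [w2 E2] : exists i : 'I_n, nat_of_ord i = 0 by apply: ord_of_nat; lia.
have [w3 E3] : exists i : 'I_n, nat_of_ord i = 1%N by apply: ord_of_nat; lia.
have [w4 E4] : exists i : 'I_n, nat_of_ord i = 2 by apply: ord_of_nat; lia.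
have [w5 E5] : exists i : 'I_n, nat_of_ord i = 3 by apply: ord_of_nat; lia.
have [p Ep] : exists i : 'I_n, nat_of_ord i = a by apply: ord_of_nat; lia.
apply: (@short_cyc3I w3 w4 w5); rewrite ?E3 ?E4 ?E5; try rot_lia.
apply: (@word_leW _ _ 44) => //; apply: (@comm_cyc3 _ _ al p w0 w1 w2).
- by rewrite /= !inE -!val_eqE /= Ep E0 E1 E2 E3 E4 E5; lia.
- by split; apply: alphaP; rewrite ?E0 ?E1 ?E2 ?E3 ?E4 ?E5; rot_lia.
- by apply: alphaP; rewrite Ep; rot_lia.
- exact: word_le_alpha.
by rewrite -puzzle_comm //; first [exact: word_le_comm | lia].
Qed.

(** Mirror image along beta, with [p] = 0 off beta. Gamma descends through these vertices, hence the
    inverse 3-cycle. *)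
Lemma short_cyc3_b6 : 5 < b -> 2 < a -> short_cyc3.
Proof.
move=> b6 a3; have En : n = a + b - 2 by [].
have [w0 E0] : exists i : 'I_n, nat_of_ord i = a - 2 by apply: ord_of_nat; lia.
have [w1 E1] : exists i : 'I_n, nat_of_ord i = a - 1 by apply: ord_of_nat; lia.
have [w2 E2] : exists i : 'I_n, nat_of_ord i = a by apply: ord_of_nat; lia.
have [w3 E3] : exists i : 'I_n, nat_of_ord i = a.+1 by apply: ord_of_nat; lia.
have [w4 E4] : exists i : 'I_n, nat_of_ord i = a.+2 by apply: ord_of_nat; lia.
have [w5 E5] : exists i : 'I_n, nat_of_ord i = a.+3 by apply: ord_of_nat; lia.
have [p Ep] : exists i : 'I_n, nat_of_ord i = 0 by apply: ord_of_nat; lia.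
have u7 : uniq [:: p; w0; w1; w2; w3; w4; w5].
  by rewrite /= !inE -!val_eqE /= Ep E0 E1 E2 E3 E4 E5; lia.
apply: (@short_cyc3I w5 w4 w3); rewrite ?E3 ?E4 ?E5; try rot_lia.
have -> : cyc3 w5 w4 w3 = (cyc3 w3 w4 w5)^-1.
  rewrite cyc3V cyc3_rot 1?cyc3_rot // /= !inE -!val_eqE /= E3 E4 E5; lia.
apply: word_leV; first exact: puzzle_shiftsV.
apply: (@word_leW _ _ 44) => //; apply: (@comm_cyc3 _ _ be p w0 w1 w2) => //.
- by split; apply: betaP; rewrite ?E0 ?E1 ?E2 ?E3 ?E4 ?E5; rot_lia.
- by apply: betaP; rewrite Ep; rot_lia.
- exact: word_le_beta.
by rewrite -puzzle_comm //; first [exact: word_le_comm | lia].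
Qed.

End ShortThreeCycle.

(** Vertex-by-vertex check; eight cases cover the largest puzzle treated this way, a = b = 5. *)
Ltac perm_compute :=
  let i := fresh "i" in
  apply/permP=> i; apply: ord_inj; rewrite !permM;
  rewrite ?(val_tperm, val_betaV, val_beta, val_alphaV, val_alpha) //;
  do ?[match goal with H : nat_of_ord _ = _ |- _ => rewrite ?H; clear H end];
  case: i => i /=; rewrite /puzzle_n;
  do 8 (case: i => [|i]; first by []); by [].

Lemma short_cyc3_45 : short_cyc3 4 5.
Proof.
have [z0 E0] : exists i : 'I_(puzzle_n 4 5), nat_of_ord i = 0 by apply: ord_of_nat.
have [z1 E1] : exists i : 'I_(puzzle_n 4 5), nat_of_ord i = 1%N by apply: ord_of_nat.
have [z3 E3] : exists i : 'I_(puzzle_n 4 5), nat_of_ord i = 3 by apply: ord_of_nat.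
apply: (@short_cyc3I _ _ _ _ z3 z0 z1); rewrite ?E0 ?E1 ?E3 //.
pose al := puzzle_alpha 4 5; pose be := puzzle_beta 4 5.
(* [al * be] is a 3-cycle times a disjoint 4-cycle, so its fourth power is that 3-cycle. *)
have -> : cyc3 z3 z0 z1 = al * be * al * be * al * be * al * be by perm_compute.
exists [:: al; be; al; be; al; be; al; be]; split=> //.
  by rewrite /= !inE !eqxx !orbT.
by rewrite unlock /= mulg1 !mulgA.
Qed.

Lemma short_cyc3_54 : short_cyc3 5 4.
Proof.
have [z6 E6] : exists i : 'I_(puzzle_n 5 4), nat_of_ord i = 6 by apply: ord_of_nat.
have [z5 E5] : exists i : 'I_(puzzle_n 5 4), nat_of_ord i = 5 by apply: ord_of_nat.
have [z4 E4] : exists i : 'I_(puzzle_n 5 4), nat_of_ord i = 4 by apply: ord_of_nat.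
apply: (@short_cyc3I _ _ _ _ z6 z5 z4); rewrite ?E4 ?E5 ?E6 //.
pose al := puzzle_alpha 5 4; pose be := puzzle_beta 5 4.
(* The word is (al be)^4 be^-2: the 3-cycle (3 5 6) followed by the double transposition (3 5)(4
   6). *)
have -> : cyc3 z6 z5 z4 = al * be * al * be * al * be * al * be^-1 by perm_compute.
exists [:: al; be; al; be; al; be; al; be^-1]; split=> //.
  by rewrite /= !inE !eqxx !orbT.
by rewrite unlock /= mulg1 !mulgA.
Qed.

Lemma short_cyc3_55 : short_cyc3 5 5.
Proof.
have [z0 E0] : exists i : 'I_(puzzle_n 5 5), nat_of_ord i = 0 by apply: ord_of_nat.
have [z1 E1] : exists i : 'I_(puzzle_n 5 5), nat_of_ord i = 1%N by apply: ord_of_nat.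
have [z2 E2] : exists i : 'I_(puzzle_n 5 5), nat_of_ord i = 2 by apply: ord_of_nat.
apply: (@short_cyc3I _ _ _ _ z0 z1 z2); rewrite ?E0 ?E1 ?E2 //.
pose al := puzzle_alpha 5 5; pose be := puzzle_beta 5 5.
rewrite -[cyc3 _ _ _]invgK cyc3V; apply: word_leV; first exact: puzzle_shiftsV.
have -> : cyc3 z0 z2 z1 = al * al * be * al^-1 * al^-1 * be^-1 * al * be * al * be^-1.
  by perm_compute.
exists [:: al; al; be; al^-1; al^-1; be^-1; al; be; al; be^-1]; split=> //.
  by rewrite /= !inE !eqxx !orbT.
by rewrite unlock /= mulg1 !mulgA.
Qed.

Lemma short_cyc3P a b : 1 < a -> 1 < b -> 3 < puzzle_n a b ->
  ~ (a = 4 /\ b = 4) -> short_cyc3 a b.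
Proof.
move=> a1 b1 n4 nab.
have [a2|a2] := eqVneq a 2; first exact: short_cyc3_a2.
have [b2|b2] := eqVneq b 2; first exact: short_cyc3_b2.
have [a3|a3] := eqVneq a 3; first by apply: short_cyc3_a3 => //; lia.
have [b3|b3] := eqVneq b 3; first by apply: short_cyc3_b3 => //; lia.
have [a6|a6] := ltnP 5 a; first by apply: short_cyc3_a6 => //; lia.
have [b6|b6] := ltnP 5 b; first by apply: short_cyc3_b6 => //; lia.
have [[a4|a5] [b4|b5]] : (a = 4 \/ a = 5) /\ (b = 4 \/ b = 5) by lia.
- by case: nab.
- by rewrite a4 b5; apply: short_cyc3_45.
- by rewrite a5 b4; apply: short_cyc3_54.
by rewrite a5 b5; apply: short_cyc3_55.
Qed.

(** * The orbits of gamma *)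

Lemma mem_porbitS (T : finType) (s : {perm T}) x y :
  y \in porbit s x -> s y \in porbit s x.
Proof. by move=> /porbitP[k ->]; rewrite -permM -expgSr mem_porbit. Qed.

(* Starting from vertex 1, alpha * beta^-1 runs through 1, ..., a-2 and then
   down through n, n-1, ..., a. *)
Lemma porbit_gamma a b (r u : 'I_(puzzle_n a b)) : 1 < a -> 1 < b -> 2 < puzzle_n a b ->
  nat_of_ord r = a - 2 -> u != r ->
  porbit (puzzle_alpha a b * (puzzle_beta a b)^-1) u = [set~ r].
Proof.
move=> a1 b1 n3 Er ur; set ga := _ * _.
have En : (puzzle_n a b) = a + b - 2 by [].
have gar : ga r = r by apply: gammaP => //; rewrite Er; rot_lia.
pose x i := if i < a - 2 then i else a + (puzzle_n a b) - 3 - i.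
have ltx i : i < (puzzle_n a b).-1 -> x i < (puzzle_n a b) by rewrite /x; case: ifP; lia.
have [u0 Eu0] := ord_of_nat (ltx 0 (ltac:(lia))).
have orb0 i (y : 'I_(puzzle_n a b)) :
    i < (puzzle_n a b).-1 -> nat_of_ord y = x i -> y \in porbit ga u0.
  elim: i y => [|i IHi] y lti Ey.
    by rewrite (_ : y = u0) ?porbit_id //; apply: ord_inj; rewrite Ey Eu0.
  have lti' : i < (puzzle_n a b).-1 by lia.
  have [z Ez] := ord_of_nat (ltx i lti').
  rewrite (_ : y = ga z); first exact/mem_porbitS/(IHi z).
  apply/esym/gammaP => //; rewrite Ey Ez /x; repeat case: ifP; rot_lia.
have orb y : y != r -> y \in porbit ga u0.
  rewrite -val_eqE /= Er => yr; have := ltn_ord y; move=> lty.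
  (* Away from [a - 2] the enumeration [x] is its own inverse, so [x y] is the index of [y]. *)
  apply: (orb0 (x y)); rewrite /x; repeat case: ifP; lia.
suff Eorb : porbit ga u0 = [set~ r].
  by rewrite -Eorb; apply/eqP; rewrite eq_porbit_mem orb.
have porb_r : porbit ga r = [set r].
  apply/setP=> y; rewrite inE; apply/idP/eqP => [/porbitP[k ->]|->]; last exact: porbit_id.
  by elim: k => [|k IHk]; rewrite ?perm1 // expgSr permM IHk.
apply/setP=> y; rewrite !inE; apply/idP/idP => [|/orb//].
apply: contraTneq => ->; rewrite porbit_sym porb_r inE -val_eqE /= Eu0 Er /x.
by case: ifP; lia.
Qed.

(** * Parity of the two cycles *)

Lemma cycle_perm_cons2 (T : finType) (x y : T) s : uniq (x :: y :: s) ->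
  cycle_perm (x :: y :: s) = tperm x y * cycle_perm (x :: s).
Proof.
move=> Us; have Us' : uniq (x :: s).
  by move: Us; rewrite /= inE negb_or => /and3P[/andP[_ ->] _ ->].
have [xy yx ys] : [/\ x != y, y != x & y \notin s].
  by move: Us; rewrite /= inE negb_or eq_sym => /and3P[/andP[-> _] -> _].
apply/permP=> z; rewrite permM !cycle_permE //.
case: tpermP => [->|->|/eqP/negPf zx /eqP/negPf zy] /=.
- by rewrite eqxx -[RHS]/(next (x :: s) y) next_nth inE (negPf yx) (negPf ys).
- by rewrite (negPf yx); case: s {Us Us' ys} => [|w s] /=; rewrite !eqxx.
by rewrite zx; case: s {Us Us' ys} => [|w s] /=; rewrite ?zx ?zy.
Qed.

Lemma odd_cycle_perm (T : finType) (x : T) s : uniq (x :: s) ->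
  cycle_perm (x :: s) = odd (size s) :> bool.
Proof.
elim: s => [_|y s IHs Us].
  have -> : cycle_perm [:: x] = 1; last by rewrite odd_perm1.
  by apply/permP=> z; rewrite perm1 cycle_permE //= ; case: eqP.
have Us' : uniq (x :: s).
  by move: Us; rewrite /= inE negb_or => /and3P[/andP[_ ->] _ ->].
rewrite cycle_perm_cons2 // odd_permM IHs // odd_tperm.
by move: Us; rewrite /= inE negb_or => /andP[/andP[-> _] _].
Qed.

Lemma odd_cycle_iota n k l : 0 < l -> k + l <= n ->
  (cycle_perm (pmap insub (iota k l)) : {perm 'I_n}) = ~~ odd l :> bool.
Proof.
move=> l0 kln; have sn : all (gtn n) (iota k l).
  by apply/allP=> x; rewrite mem_iota /=; lia.
have : uniq (pmap (insub : nat -> option 'I_n) (iota k l)).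
  by rewrite pmap_sub_uniq ?iota_uniq.
have := size_map val (pmap (insub : nat -> option 'I_n) (iota k l)).
rewrite val_pmap_insub // size_iota.
case: pmap => [|x s] /=; first by lia.
by move=> -> Us; rewrite odd_cycle_perm //= negbK.
Qed.

Lemma odd_alpha a b : 1 < a -> 1 < b -> puzzle_alpha a b = ~~ odd a :> bool.
Proof. by move=> a1 b1; rewrite odd_cycle_iota // /puzzle_n; lia. Qed.

Lemma odd_beta a b : 1 < a -> 1 < b -> puzzle_beta a b = ~~ odd b :> bool.
Proof. by move=> a1 b1; rewrite odd_cycle_iota // /puzzle_n; lia. Qed.

(** * The group and its word lengths outside a = b = 4 *)

Lemma even_puzzle_word a b : 1 < a -> 1 < b -> ~ (a = 4 /\ b = 4) ->
  forall s : {perm 'I_(puzzle_n a b)}, ~~ odd_perm s ->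
  word_le (puzzle_shifts a b) (45 * 50 * puzzle_n a b ^ 2) s.
Proof.
move=> a1 b1 nab; have En : puzzle_n a b = a + b - 2 by [].
have invS := @puzzle_shiftsV a b.
have Wa := word_le_alpha a b; have Wb := word_le_beta a b.
have [n4|n3] := ltnP 3 (puzzle_n a b).
  have [r Er] : exists r : 'I_(puzzle_n a b), nat_of_ord r = a - 2.
    by apply: ord_of_nat; lia.
  have [u ur Wu] := short_cyc3P a1 b1 n4 nab => s even_s.
  have card_n := card_ord (puzzle_n a b).
  suff: word_le (puzzle_shifts a b) (45 * 50 * #|'I_(puzzle_n a b)| ^ 2) s by rewrite card_n.
  (* The cycle is gamma, and alpha serves as [e] since it moves the vertex a-1 fixed by gamma. *)
  apply: (even_word_le_cycle invS (r := r) (e := puzzle_alpha a b)) Wu _ even_s.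
  - by rewrite card_n.
  - by rewrite (porbit_gamma (r := r)) //; [lia | rewrite -val_eqE /= Er].
  - by rewrite -val_eqE /= val_alpha // Er; rot_lia.
  - by apply: word_leW (word_leM Wa (word_leV invS Wb)).
  by apply: word_leW Wa.
(* At most three vertices remain. A 3-cycle exists only for n = 3, where the longer of alpha and
   beta is one. *)
have [z0 E0] : exists i : 'I_(puzzle_n a b), nat_of_ord i = 0 by apply: ord_of_nat; lia.
have [z1 E1] : exists i : 'I_(puzzle_n a b), nat_of_ord i = 1%N by apply: ord_of_nat; lia.
have z01 : z0 != z1 by rewrite -val_eqE /= E0 E1.
move=> s even_s; apply: (@word_leW _ _ (#|'I_(puzzle_n a b)| * 1)).
  by rewrite card_ord; nia.
apply: (even_word_le invS z01 _ even_s) => y z {s even_s}.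
rewrite /= !inE -!val_eqE /= E0 => u3.
have [ly lz] : y < puzzle_n a b /\ z < puzzle_n a b by rewrite !ltn_ord.
have En3 : puzzle_n a b = 3 by lia.
have [z2 E2] : exists i : 'I_(puzzle_n a b), nat_of_ord i = 2 by apply: ord_of_nat; lia.
have W12 : word_le (puzzle_shifts a b) 1 (cyc3 z0 z1 z2).
  have [[a2 b3]|[a3 b2]] : a = 2 /\ b = 3 \/ a = 3 /\ b = 2 by lia.
    rewrite (_ : cyc3 z0 z1 z2 = puzzle_beta a b) //.
    by move: z0 z1 z2 E0 E1 E2 {z01 Wa Wb u3 invS}; subst a b => *; perm_compute.
  rewrite (_ : cyc3 z0 z1 z2 = puzzle_alpha a b) //.
  by move: z0 z1 z2 E0 E1 E2 {z01 Wa Wb u3 invS}; subst a b => *; perm_compute.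
have [[Ey Ez]|[Ey Ez]] : nat_of_ord y = 1%N /\ nat_of_ord z = 2 \/
  nat_of_ord y = 2 /\ nat_of_ord z = 1%N by lia.
  have -> : y = z1 by apply: ord_inj; rewrite Ey E1.
  by have -> : z = z2 by apply: ord_inj; rewrite Ez E2.
rewrite -cyc3V; apply: word_leV => //.
have -> : y = z2 by apply: ord_inj; rewrite Ey E2.
by have -> : z = z1 by apply: ord_inj; rewrite Ez E1.
Qed.

(** A finite group has a longest minimal word; this serves the single puzzle a = b = 4. *)
Lemma word_le_bounded (gT : finGroupType) (S : seq gT) :
  exists K, forall g, g \in <<[set x in S]>> -> word_le S K g.
Proof.
have H (g : gT) : exists l, g \in <<[set x in S]>> -> word_le S l g.
  have [/gen_prodgP[l [c Sc ->]]|] := boolP (g \in _); last by exists 0.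
  exists l => _; exists [seq c i | i <- index_enum 'I_l]; split.
  - by rewrite size_map /index_enum -enumT size_enum_ord.
  - by apply/allP=> _ /mapP[i _ ->]; have := Sc i; rewrite inE.
  by rewrite big_map.
have [f Wf] := fin_all_exists H.
exists (\max_(g : gT) f g) => g /Wf; apply: word_leW.
exact: leq_bigmax.
Qed.

Lemma puzzle_groupE a b : puzzle_group a b = <<[set x in puzzle_shifts a b]>> :> {set _}.
Proof.
apply/eqP; rewrite eqEsubset !gen_subG; apply/andP; split; apply/subsetP=> g.
  by rewrite !inE => /orP[]/eqP->; apply: mem_gen; rewrite !inE eqxx ?orbT.
by rewrite !inE => /or4P[]/eqP->; rewrite ?groupV; apply: mem_gen; rewrite !inE eqxx ?orbT.
Qed.

(** All even permutations being words, only the existence of an odd generator, that is a cycle of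
    even length, remains to be decided. *)
Lemma puzzle_groupP a b : 1 < a -> 1 < b -> ~ (a = 4 /\ b = 4) ->
  puzzle_group a b :=:
    (if odd a && odd b then 'Alt_('I_(puzzle_n a b)) else 'Sym_('I_(puzzle_n a b))).
Proof.
move=> a1 b1 nab.
have even_mem (s : {perm 'I_(puzzle_n a b)}) : ~~ odd_perm s -> s \in puzzle_group a b.
  move=> /(even_puzzle_word a1 b1 nab) /word_le_mem_gen; by rewrite -puzzle_groupE.
have al_mem : puzzle_alpha a b \in puzzle_group a b by apply: mem_gen; rewrite !inE eqxx.
have be_mem : puzzle_beta a b \in puzzle_group a b by apply: mem_gen; rewrite !inE eqxx orbT.
have oa := odd_alpha a1 b1; have ob := odd_beta a1 b1.
case: ifPn => [/andP[odda oddb] | /nandP odd_ab].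
  apply/eqP; rewrite eqEsubset gen_subG; apply/andP; split; apply/subsetP=> s.
    by move=> /set2P[]->; rewrite Alt_even ?oa ?ob ?odda ?oddb.
  by rewrite Alt_even; apply: even_mem.
apply/eqP; rewrite eqEsubset subsetT; apply/subsetP=> s _.
have [odd_s|/even_mem//] := boolP (odd_perm s).
case: odd_ab => [odda|oddb].
  rewrite -[s](mulgKV (puzzle_alpha a b)) groupM // even_mem //.
  by rewrite odd_permM odd_permV odd_s oa odda.
rewrite -[s](mulgKV (puzzle_beta a b)) groupM // even_mem //.
by rewrite odd_permM odd_permV odd_s ob oddb.
Qed.

(** 2251 = 45 * 50 + 1: an odd element becomes even after one odd generator. Without an odd
    generator the group is alternating. *)
Lemma puzzle_word a b : 1 < a -> 1 < b -> ~ (a = 4 /\ b = 4) ->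
  forall h, h \in puzzle_group a b ->
  word_le (puzzle_shifts a b) (2251 * puzzle_n a b ^ 2) h.
Proof.
move=> a1 b1 nab h Hh; have We := even_puzzle_word a1 b1 nab.
have n0 : 0 < puzzle_n a b ^ 2 by rewrite expn_gt0 /puzzle_n; lia.
have [odd_h|/We] := boolP (odd_perm h); last by apply: word_leW; lia.
have step g : word_le (puzzle_shifts a b) 1 g -> odd_perm g ->
    word_le (puzzle_shifts a b) (2251 * puzzle_n a b ^ 2) h.
  move=> Wg odd_g; rewrite -[h](mulgKV g).
  have even_hg : ~~ odd_perm (h * g^-1) by rewrite odd_permM odd_permV odd_h odd_g.
  by apply: word_leW (word_leM (We _ even_hg) Wg); lia.
have [odd_a|even_a] := boolP (odd_perm (puzzle_alpha a b)).
  exact: step (word_le_alpha a b) odd_a.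
have [odd_b|even_b] := boolP (odd_perm (puzzle_beta a b)).
  exact: step (word_le_beta a b) odd_b.
move: Hh; rewrite puzzle_groupP //.
have -> : odd a by move: even_a; rewrite odd_alpha // negbK.
have -> : odd b by move: even_b; rewrite odd_beta // negbK.
by rewrite Alt_even odd_h.
Qed.

(* A 1-factorization of K_6 (one of Sylvester's totals) permuted by the two
   4-cycles: [factor i x] is the partner of [x] in the i-th perfect matching. *)
Definition factor (i x : nat) : nat :=
  nth 0 (nth [::] [:: [:: 1; 0; 4; 5; 2; 3]; [:: 2; 3; 0; 1; 5; 4]; [:: 3; 4; 5; 0; 1; 2];
                      [:: 4; 5; 3; 2; 0; 1]; [:: 5; 2; 1; 4; 3; 0]]%N i) x.

(** * The isomorphism with S_5 for a = b = 4 *)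

(** Pairs (g, s) where g carries matching i to matching s(i). The matchings are indexed by the five
    vertices of the puzzle a = 2, b = 5, whose group is already known to be S_5. *)
Definition factor_perms : {set {perm 'I_(puzzle_n 4 4)} * {perm 'I_(puzzle_n 2 5)}} :=
  [set u : {perm 'I_(puzzle_n 4 4)} * {perm 'I_(puzzle_n 2 5)} |
    [forall i : 'I_(puzzle_n 2 5), forall x : 'I_(puzzle_n 4 4), forall y : 'I_(puzzle_n 4 4),
      (nat_of_ord y == factor i x) ==> (nat_of_ord (u.1 y) == factor (u.2 i) (u.1 x))]].

Lemma factor_permsP (u : {perm 'I_(puzzle_n 4 4)} * {perm 'I_(puzzle_n 2 5)}) : reflect
  (forall (i : 'I_(puzzle_n 2 5)) (x y : 'I_(puzzle_n 4 4)), nat_of_ord y = factor i x ->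
     nat_of_ord (u.1 y) = factor (u.2 i) (u.1 x))
  (u \in factor_perms).
Proof.
rewrite inE; apply: (iffP forallP) => [H i x y /eqP Ey|H i].
  by have /forallP/(_ x)/forallP/(_ y)/implyP/(_ Ey)/eqP := H i.
by apply/forallP=> x; apply/forallP=> y; apply/implyP=> /eqP Ey; apply/eqP/H.
Qed.

Lemma group_set_factor_perms : group_set factor_perms.
Proof.
apply/group_setP; split; first by apply/factor_permsP=> i x y; rewrite !perm1.
move=> u v /factor_permsP Hu /factor_permsP Hv; apply/factor_permsP=> i x y Ey.
by rewrite /= !permM; apply/Hv/Hu.
Qed.

Lemma factor_lt i x : factor i x < 6.
Proof.
rewrite /factor; do 5 (case: i => [|i]; first by do 6 (case: x => [|x] //); case: x).
by rewrite [nth [::] _ _]nth_default // nth_nil.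
Qed.

Lemma factor0 (i : 'I_(puzzle_n 2 5)) : factor i 0 = i.+1.
Proof. by case: i => i; rewrite /factor /puzzle_n /=; do 5 (case: i => [|i] //). Qed.

Lemma exists_factor (i : 'I_(puzzle_n 2 5)) (x : 'I_(puzzle_n 4 4)) :
  exists y : 'I_(puzzle_n 4 4), nat_of_ord y = factor i x.
Proof. by apply: ord_of_nat; apply: factor_lt. Qed.

(** The partners of vertex 0 in the five matchings are distinct, so they determine the index. *)
Lemma factor_perms_fst1 u : u \in factor_perms -> u.1 = 1 -> u.2 = 1.
Proof.
move=> /factor_permsP Hu u1; apply/permP=> i; apply: ord_inj; rewrite perm1.
have [x Ex] : exists x : 'I_(puzzle_n 4 4), nat_of_ord x = 0 by apply: ord_of_nat.
have [y Ey] := exists_factor i x; have := Hu i x y Ey.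
by rewrite u1 !perm1 Ey Ex !factor0 => -[].
Qed.

(* A permutation [g] commuting with all the matchings is determined by [c = g 0]:
   it sends [factor i 0 = i + 1] to [factor i c]. *)
Definition factor_commuting (c z : nat) : nat := if z is i.+1 then factor i c else c.

Lemma factor_perms_snd1 u : u \in factor_perms -> u.2 = 1 -> u.1 = 1.
Proof.
case: u => g s /= /factor_permsP /= Hu s1; rewrite {}s1 in Hu.
have [z Ez] : exists x : 'I_(puzzle_n 4 4), nat_of_ord x = 0 by apply: ord_of_nat.
move Ec : (nat_of_ord (g z)) => c.
have gE x : nat_of_ord (g x) = factor_commuting c x.
  case Ex : (nat_of_ord x) => [|i].
    by rewrite -Ec; congr (nat_of_ord (g _)); apply: ord_inj; rewrite Ex Ez.
  have lti : i < puzzle_n 2 5 by have := ltn_ord x; rewrite Ex.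
  by rewrite (Hu (Ordinal lti) z) ?perm1 ?Ec // Ez factor0.
have comm i x : i < 5 -> x < 6 ->
    factor_commuting c (factor i x) = factor i (factor_commuting c x).
  move=> lti ltx; have [y Ey] := exists_factor (Ordinal lti) (Ordinal ltx).
  by have := Hu _ _ _ Ey; rewrite perm1 !gE Ey.
have ltc : c < 6 by rewrite -Ec ltn_ord.
(* Commutation at four chosen pairs refutes each of the values 1, ..., 5. *)
have c0 : c = 0.
  move: ltc (comm 0 1%N isT isT) (comm 0 2 isT isT) (comm 1%N 0 isT isT) (comm 1%N 1%N isT isT).
  by clear; do 6 (case: c => [|c] //).
apply/permP=> x; apply: ord_inj; rewrite perm1 gE c0.
have := ltn_ord x; case: (nat_of_ord x) => [|i] //; rewrite /puzzle_n => lti.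
by rewrite /factor_commuting; do 5 (case: i lti => [|i] // lti).
Qed.

Local Notation al4 := (puzzle_alpha 4 4).
Local Notation be4 := (puzzle_beta 4 4).
Local Notation al5 := (cycle_perm (pmap insub [:: 0; 4; 3; 2]) : {perm 'I_(puzzle_n 2 5)}).
Local Notation be5 := (cycle_perm (pmap insub [:: 1%N; 2; 3; 4]) : {perm 'I_(puzzle_n 2 5)}).

Lemma mem_factor_perms (f s : nat -> nat)
    (g : {perm 'I_(puzzle_n 4 4)}) (h : {perm 'I_(puzzle_n 2 5)}) :
  (forall x, nat_of_ord (g x) = f x) -> (forall i, nat_of_ord (h i) = s i) ->
  all (fun i => all (fun x => f (factor i x) == factor (s i) (f x)) (iota 0 6)) (iota 0 5) ->
  (g, h) \in factor_perms.
Proof.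
move=> gf hs /allP H; apply/factor_permsP=> i x y Ey; rewrite /= !gf hs Ey.
have /H/allP Hi : nat_of_ord i \in iota 0 5 by rewrite mem_iota ltn_ord.
by apply/eqP/Hi; rewrite mem_iota; apply: ltn_ord.
Qed.

Lemma al_factor_perms : (al4, al5) \in factor_perms.
Proof.
apply: (@mem_factor_perms (rotn 0 4) (next [:: 0; 4; 3; 2])) => // i.
  exact: val_alpha.
exact: val_cycle_perm.
Qed.

Lemma be_factor_perms : (be4, be5) \in factor_perms.
Proof.
apply: (@mem_factor_perms (rotn 2 6) (next [:: 1%N; 2; 3; 4])) => // i.
  exact: val_beta.
exact: val_cycle_perm.
Qed.

(** The square of the 5-cycle [al5 * be5^-1] is the 5-cycle of the puzzle a = 2, b = 5; one more
    factor [al5] turns it into the transposition of that puzzle. *)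
Lemma puzzle_alpha25 : puzzle_alpha 2 5 = al5 * be5^-1 * al5 * be5^-1 * al5.
Proof.
apply/permP=> i; apply: ord_inj.
rewrite !permM val_alpha // !(val_cycle_perm, val_cycle_permV) //.
by case: i => i; do 5 (case: i => [|i] //).
Qed.

Lemma puzzle_beta25 : puzzle_beta 2 5 = al5 * be5^-1 * al5 * be5^-1.
Proof.
apply/permP=> i; apply: ord_inj.
rewrite !permM val_beta // !(val_cycle_perm, val_cycle_permV) //.
by case: i => i; do 5 (case: i => [|i] //).
Qed.

Lemma gen_al5_be5 : <<[set al5; be5]>> = [set: {perm 'I_(puzzle_n 2 5)}].
Proof.
have Hg : puzzle_group 2 5 :=: [set: {perm 'I_(puzzle_n 2 5)}].
  by rewrite puzzle_groupP // => -[].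
apply/eqP; rewrite eqEsubset subsetT -Hg gen_subG.
have Ha : al5 \in <<[set al5; be5]>> by apply: mem_gen; rewrite !inE eqxx.
have Hb : be5 \in <<[set al5; be5]>> by apply: mem_gen; rewrite !inE eqxx orbT.
apply/subsetP=> g /set2P[]->; rewrite ?puzzle_alpha25 ?puzzle_beta25; by rewrite !groupM ?groupV.
Qed.

Lemma isog_inj_morphim (aT rT : finGroupType) (D G : {group aT}) (f : {morphism D >-> rT}) :
  G \subset D -> {in G, forall x, f x = 1 -> x = 1} -> G \isog f @* G.
Proof.
move=> sGD inj_f; rewrite -(im_restrm sGD); apply: sub_isog => //.
by apply/subsetP=> x /morphpreP[Gx /set1P fx1]; apply/set1P/inj_f.
Qed.

(** The pairs [(al4, al5)] and [(be4, be5)] generate a subgroup of the direct product on which both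
    projections are injective; the images are the puzzle group and S_5. *)
Lemma puzzle44_isog : puzzle_group 4 4 \isog [set: {perm 'I_(puzzle_n 2 5)}].
Proof.
pose A := [set (al4, al5); (be4, be5)].
have sAF : <<A>> \subset Group group_set_factor_perms.
  rewrite gen_subG; apply/subsetP=> u /set2P[]->; [exact: al_factor_perms | exact: be_factor_perms].
have fstA : fst @* <<A>> = puzzle_group 4 4.
  rewrite morphim_gen ?subsetT //= morphimEsub ?subsetT //= /A.
  by rewrite imsetU1 imset_set1.
have sndA : snd @* <<A>> = [set: {perm 'I_(puzzle_n 2 5)}].
  rewrite morphim_gen ?subsetT //= morphimEsub ?subsetT //= /A.
  by rewrite imsetU1 imset_set1 gen_al5_be5.
have isof : <<A>> \isog puzzle_group 4 4.
  rewrite -fstA; apply: isog_inj_morphim => [|u /(subsetP sAF) Fu u1]; first exact: subsetT.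
  have := factor_perms_fst1 Fu u1; by case: u u1 {Fu} => g h /= -> ->.
have isos : <<A>> \isog [set: {perm 'I_(puzzle_n 2 5)}].
  rewrite -sndA; apply: isog_inj_morphim => [|u /(subsetP sAF) Fu u1]; first exact: subsetT.
  have := factor_perms_snd1 Fu u1; by case: u u1 {Fu} => g h /= -> ->.
by apply: isog_trans isos; rewrite isog_sym.
Qed.

Theorem theorem2 :
  (forall a b : nat, (1 < a)%N -> (1 < b)%N ->
     [/\ (a = 4 /\ b = 4 -> puzzle_group a b \isog [set: {perm 'I_(puzzle_n a b - 1)}]),
         (odd a && odd b -> (puzzle_group a b :=: 'Alt_('I_(puzzle_n a b))))
       & (~ (a = 4 /\ b = 4) -> ~~ (odd a && odd b) ->
            (puzzle_group a b :=: 'Sym_('I_(puzzle_n a b))))])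
  /\
  (exists K : nat, forall a b : nat, (1 < a)%N -> (1 < b)%N ->
     forall h, h \in puzzle_group a b ->
       exists s : seq {perm 'I_(puzzle_n a b)},
         [/\ (size s <= K * (puzzle_n a b) ^ 2)%N,
             all (fun g => g \in puzzle_shifts a b) s
           & h = \prod_(g <- s) g]).
Proof.
split=> [a b a1 b1|].
  split=> [[a4 b4] | odd_ab | nab /negPf odd_ab].
  (* [puzzle_n 4 4 - 1] and [puzzle_n 2 5] both compute to 5. *)
  - by subst a b; exact: puzzle44_isog.
  - by rewrite puzzle_groupP ?odd_ab // => -[a4 _]; rewrite a4 in odd_ab.
  by rewrite puzzle_groupP // odd_ab.
have [K WK] := word_le_bounded (puzzle_shifts 4 4).
(* [K] handles a = b = 4 and 2251 all other puzzles; the sum serves both. *)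
exists (K + 2251) => a b a1 b1 h Hh; rewrite -/(word_le _ _ h).
have n0 : 0 < puzzle_n a b ^ 2 by rewrite expn_gt0 /puzzle_n; lia.
have [/andP[/eqP a4 /eqP b4] | nab] := boolP ((a == 4) && (b == 4)).
  subst a b; rewrite puzzle_groupE in Hh; apply: word_leW (WK h Hh); nia.
have W : word_le (puzzle_shifts a b) (2251 * puzzle_n a b ^ 2) h.
  by apply: puzzle_word => // -[a4 b4]; rewrite a4 b4 in nab.
by apply: word_leW W; rewrite leq_mul2r leq_addl orbT.
Qed.
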